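(* Let $X$ be a set with $|X|\ge 3$, let $n\ge 3$ be an integer, and let $F\colon X^n\to X$ be an associative operation such that $E_F\neq\varnothing$. Then every reduction of $F$ is of the form $G_e$ for some $e\in E_F$. Moreover, if $e_1,e_2\in E_F$, then the semigroups $(X,G_{e_1})$ and $(X,G_{e_2})$ are isomorphic.
   Context: Notation: $k\boldsymbol{\cdot} x$ stands for the $k$-tuple $x,\ldots,x$. An operation $F\colon X^n\to X$ is associative if $F(x_1,\ldots,x_{i-1},F(x_i,\ldots,x_{i+n-1}),x_{i+n},\ldots,x_{2n-1})=F(x_1,\ldots,x_i,F(x_{i+1},\ldots,x_{i+n}),x_{i+n+1},\ldots,x_{2n-1})$ for all $x_1,\ldots,x_{2n-1}\in X$ and $1\le i\le n-1$. An element $e\in X$ is neutral for $F\colon X^n\to X$ if $F((k-1)\boldsymbol{\cdot} e,x,(n-k)\boldsymbol{\cdot} e)=x$ for all $x\in X$ and $k\in\{1,\ldots,n\}$; $E_F$ is the set of neutral elements of $F$. For $e\in E_F$, $G_e\colon X^2\to X$ is defined by $G_e(x,y)=F(x,(n-2)\boldsymbol{\cdot} e,y)$. For a binary associative $G\colon X^2\to X$, define $G^1=G$ and $G^m(x_1,\ldots,x_{m+1})=G^{m-1}(x_1,\ldots,x_{m-1},G(x_m,x_{m+1}))$ for $m\ge 2$. A (binary) reduction of $F$ is an associative operation $G\colon X^2\to X$ such that $F=G^{n-1}$. *)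

(* Defs.v *)
From mathcomp Require Import all_boot.
From mathcomp Require Import zify.

Set Implicit Arguments.
Unset Strict Implicit.
Unset Printing Implicit Defensive.

Definition nary (n : nat) (X : Type) := n.-tuple X -> X.

Lemma size_window n (X : Type) (s : (2 * n - 1).-tuple X) (i : nat) :
  i < n -> size (take n (drop i s)) == n.
Proof.
move=> lt_in; apply/eqP; rewrite size_takel // size_drop size_tuple.
by move: lt_in; lia.
Qed.

Definition window n (X : Type) (s : (2 * n - 1).-tuple X) i (lt_in : i < n) :
  n.-tuple X := Tuple (size_window s lt_in).

Lemma size_collapse n (X : Type) (s : (2 * n - 1).-tuple X) (i : nat) (y : X) :
  i < n -> size (take i s ++ y :: drop (i + n) s) == n.
Proof.
move=> lt_in; apply/eqP; rewrite size_cat /= size_takel ?size_drop size_tuple.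
  by move: lt_in; lia.
by move: lt_in; lia.
Qed.

(* With s = (x_0, ..., x_(2n-2)), the n-tuple                                 *)
(* (x_0, ..., x_(i-1), F (x_i, ..., x_(i+n-1)), x_(i+n), ..., x_(2n-2)).      *)
Definition collapse n (X : Type) (F : nary n X) (s : (2 * n - 1).-tuple X)
    i (lt_in : i < n) : n.-tuple X :=
  Tuple (size_collapse s (F (window s lt_in)) lt_in).

Definition nary_associative n (X : Type) (F : nary n X) : Prop :=
  forall (s : (2 * n - 1).-tuple X) (i : nat) (lt_i1n : i.+1 < n),
    F (collapse F s (ltnW lt_i1n)) = F (collapse F s lt_i1n).

(* The set E_F, as a predicate. *)
Definition neutral n (X : Type) (F : nary n X) (e : X) : Prop :=
  forall (x : X) (k : 'I_n), F [tuple if j == k then x else e | j < n] = x.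

(* F (x, e, ..., e, y), meaningful for 2 <= n. *)
Definition Gop n (X : Type) (F : nary n X) (e x y : X) : X :=
  F [tuple if j == 0 :> nat then x else if j == n.-1 :> nat then y else e
     | j < n].

(* G^m, of arity m + 1; taking G^0 to be the identity makes G^1 = G and the   *)
(* recursion for m >= 2 instances of a single clause: see opow1 and opowS.    *)
Fixpoint opow (X : Type) (G : X -> X -> X) (m : nat) : nary m.+1 X :=
  match m with
  | 0 => fun t => thead t
  | m'.+1 => fun t : m'.+2.-tuple X =>
      opow G [tuple if j < m' then tnth t (inord j)
                    else G (tnth t (inord m')) (tnth t (inord m'.+1))
              | j < m'.+1]
  end.

Lemma opow1 (X : Type) (G : X -> X -> X) (x y : X) :
  opow G [tuple x; y] = G x y.
Proof. by rewrite /= /thead tnth_mktuple /= !(tnth_nth x) !inordK. Qed.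

Lemma opowS (X : Type) (G : X -> X -> X) m (s : m.-tuple X) (x y : X)
    (t : m.+2.-tuple X) (u : m.+1.-tuple X) :
  t = s ++ [:: x; y] :> seq X -> u = rcons s (G x y) :> seq X ->
  opow G t = opow G u.
Proof.
move=> tE uE /=; congr (opow G _); apply: eq_from_tnth => j.
rewrite tnth_mktuple !(tnth_nth x) tE uE.
have le_jm : j <= m by rewrite -ltnS.
have [le_jm2 le_mm2] : j < m.+2 /\ m < m.+2 by lia.
rewrite !inordK // !nth_cat nth_rcons !size_tuple ltnn subnn.
rewrite [m.+1 < m]ltnNge leqnSn subSnn /=.
by case: ltnP => // le_mj; rewrite eqn_leq le_jm le_mj.
Qed.

(* The arities n and n.-1.+1 agree propositionally when 0 < n, so tuples are  *)
(* matched through their underlying sequences.                                *)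
Definition reduction n (X : Type) (F : nary n X) (G : X -> X -> X) : Prop :=
  associative G /\
  forall (x : n.-tuple X) (y : n.-1.+1.-tuple X),
    x = y :> seq X -> F x = opow G y.

Definition isomorphic_semigroups (X Y : Type) (G : X -> X -> X)
    (H : Y -> Y -> Y) : Prop :=
  [/\ associative G, associative H &
      exists2 phi : X -> Y, bijective phi & {morph phi : x y / G x y >-> H x y}].

(* Main.v *)
Require Import Defs.
From mathcomp Require Import all_boot.
From mathcomp Require Import zify.

(* If F = G^(n-1) and e is neutral for F, then the G-power u = e^(n-1) is a   *)
(* two-sided identity of G; hence u is neutral for F and G = G_u.  For the    *)
(* isomorphism, n-ary associativity gives the mixed law                       *)
(* G_b (G_a x y) z = G_a x (G_b y z), and a, b are identities of G_a, G_b, so *)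
(* G_b (G_a x b) y = G_a x y.  Therefore x |-> G_a x b is a morphism from G_a *)
(* to G_b with inverse x |-> G_b x a.                                         *)

(** A reduction makes [F] a right-nested [G]-product ([reduction_foldr]), so the neutrality of [e]
    in the last and first places reads [G u x = x] and [G x u = x] with [u] the product of [n.-1]
    copies of [e] ([reduction_identity]). Copies of [u] then vanish from any product
    ([identity_neutral], [identity_Gop]). The isomorphism rests on [Gop_mixed_assoc], which
    evaluates the word x a...a y b...b z, of length 2n-1, in two ways. *)

Lemma rcons_nseq {T : Type} m (x : T) : rcons (nseq m x) x = nseq m.+1 x.
Proof. by rewrite -addn1 nseqD cats1. Qed.

Lemma neutral_tupleE {n : nat} {X : Type} (x e : X) (k : 'I_n) :
  [tuple if j == k then x else e | j < n]
    = nseq k e ++ x :: nseq (n.-1 - k) e :> seq X.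
Proof.
have lt_kn := ltn_ord k.
apply: (@eq_from_nth _ x) => [|i].
  by rewrite size_tuple size_cat /= !size_nseq; lia.
rewrite size_tuple => lt_in.
rewrite -[i]/(val (Ordinal lt_in)) -tnth_nth tnth_mktuple -val_eqE /=.
rewrite nth_cat size_nseq nth_nseq; case: ltngtP => // [lt_ki | ->].
  by rewrite -[i - k]prednK ?subn_gt0 //= nth_nseq ifT //; lia.
by rewrite subnn.
Qed.

Lemma Gop_tupleE {n : nat} {X : Type} (e x y : X) : 1 < n ->
  [tuple if j == 0 :> nat then x else if j == n.-1 :> nat then y else e
  | j < n] = x :: rcons (nseq n.-2 e) y :> seq X.
Proof.
case: n => [|[|n]] // _; apply: (@eq_from_nth _ x) => [|i].
  by rewrite size_tuple /= size_rcons size_nseq.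
rewrite size_tuple => lt_in.
rewrite -[i]/(val (Ordinal lt_in)) -tnth_nth tnth_mktuple /=.
case: i lt_in => [|i] lt_in //=.
rewrite nth_rcons size_nseq nth_nseq eqSS; case: ltngtP => // lt_ni.
by move: lt_in; lia.
Qed.

Section NaryOperations.

Context {X : Type} {n : nat} {F : nary n X}.

Lemma Gop_val (e x y : X) (t : n.-tuple X) : 1 < n ->
  t = x :: rcons (nseq n.-2 e) y :> seq X -> Gop F e x y = F t.
Proof. by move=> n_gt1 tE; congr F; apply: val_inj; rewrite [RHS]tE -Gop_tupleE. Qed.

Lemma neutral_val (e x : X) (k : nat) (t : n.-tuple X) : neutral F e -> k < n ->
  t = nseq k e ++ x :: nseq (n.-1 - k) e :> seq X -> F t = x.
Proof.
move=> ne lt_kn tE; rewrite -[RHS](ne x (Ordinal lt_kn)).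
by congr F; apply: val_inj; rewrite [LHS]tE -(neutral_tupleE x e (Ordinal lt_kn)).
Qed.

Section Associative.

Hypothesis F_assoc : nary_associative F.

Lemma nary_assoc_collapse (s : (2 * n - 1).-tuple X) i j
    (lt_in : i < n) (lt_jn : j < n) :
  F (collapse F s lt_in) = F (collapse F s lt_jn).
Proof.
suff from0 k (lt_0n : 0 < n) (lt_kn : k < n) :
    F (collapse F s lt_0n) = F (collapse F s lt_kn).
  by have lt_0n := leq_ltn_trans (leq0n i) lt_in; rewrite -!(from0 _ lt_0n).
elim: k lt_kn => [|k IHk] lt_kn; first by rewrite (bool_irrelevance lt_0n lt_kn).
by rewrite (IHk (ltnW lt_kn)) F_assoc.
Qed.

Lemma Gop_mixed_assoc (a b x y z : X) : 1 < n ->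
  Gop F b (Gop F a x y) z = Gop F a x (Gop F b y z).
Proof.
move=> n_gt1; have n_gt0 : 0 < n by apply: ltnW.
have lt_pn : n.-1 < n by rewrite prednK.
(* The first and last windows of [p ++ y :: q] share exactly [y]. Packing [p] and [q] with equations
   keeps [/=] from unfolding them. *)
have [[p pE] [q qE]] : {p | p = x :: nseq n.-2 a} * {q | q = rcons (nseq n.-2 b) z}.
  by split; eexists.
have szp : size p = n.-1 by rewrite pE /= size_nseq; lia.
have szq : size q = n.-1 by rewrite qE size_rcons size_nseq; lia.
have szs : size (p ++ y :: q) == 2 * n - 1.
  by rewrite size_cat [size (y :: q)]/= szp szq; lia.
have left_window : Gop F a x y = F (window (Tuple szs) n_gt0).
  apply: Gop_val => //=; rewrite -rcons_cons -pE drop0.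
  by rewrite -cat_rcons take_size_cat // size_rcons szp prednK.
have right_window : Gop F b y z = F (window (Tuple szs) lt_pn).
  apply: Gop_val => //=; rewrite -qE.
  by rewrite drop_size_cat // take_oversize //= szq prednK.
transitivity (F (collapse F (Tuple szs) n_gt0)).
  apply: Gop_val => //; rewrite /= -left_window -qE take0 add0n.
  by rewrite -(cat_rcons y p) drop_size_cat // size_rcons szp prednK.
rewrite (nary_assoc_collapse _ _ _ _ lt_pn); apply/esym/Gop_val => //.
rewrite -rcons_cons -pE /= -right_window take_size_cat //.
rewrite drop_oversize ?cats1 //.
by rewrite size_cat [size (y :: q)]/= szp szq; lia.
Qed.

End Associative.

Lemma Gop_neutral_r (e x : X) : 1 < n -> neutral F e -> Gop F e x e = x.
Proof.
move=> n_gt1 ne; rewrite /Gop (neutral_val _ x _ _ ne (ltnW n_gt1)) //.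
by rewrite Gop_tupleE //= rcons_nseq subn0; congr (_ :: nseq _ _); lia.
Qed.

Lemma Gop_neutral_l (e x : X) : 1 < n -> neutral F e -> Gop F e e x = x.
Proof.
move=> n_gt1 ne; have lt_pn : n.-1 < n by rewrite prednK // ltnW.
rewrite /Gop (neutral_val _ x _ _ ne lt_pn) // Gop_tupleE // subnn cats1.
by rewrite -rcons_cons -[e :: _]/(nseq n.-2.+1 e) prednK //; lia.
Qed.

Lemma Gop_isomorphic (a b : X) : nary_associative F -> 1 < n ->
  neutral F a -> neutral F b -> isomorphic_semigroups (Gop F a) (Gop F b).
Proof.
move=> F_assoc n_gt1 na nb.
have mixed := fun c d x y z => Gop_mixed_assoc F_assoc c d x y z n_gt1.
(* Associativity is the mixed law with equal neutral elements. *)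
split=> [x y z | x y z |]; rewrite ?mixed //.
exists (fun x => Gop F a x b) => [|x y].
  by exists (fun x => Gop F b x a) => x;
    rewrite mixed ?Gop_neutral_l ?Gop_neutral_r.
by rewrite !mixed Gop_neutral_l.
Qed.

End NaryOperations.

(** Each unfolding of [opow] contracts the last two entries, so the product nests to the right, with
    the last entry as seed. *)
Lemma opow_foldr {X : Type} (G : X -> X -> X) m (t : m.+1.-tuple X) s z :
  t = rcons s z :> seq X -> opow G t = foldr G z s.
Proof.
elim: m t s z => [|m IHm] t s z tE.
  have szs : size s = 0 by move/(congr1 size): tE; rewrite size_tuple size_rcons => -[].
  by case: s szs tE => // _; rewrite /= /thead (tnth_nth z) => ->.
case/lastP: s tE => [|s y] tE.
  by move/(congr1 size): tE; rewrite size_tuple.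
have szs : size s == m.
  by move/(congr1 size): tE; rewrite size_tuple !size_rcons => -[->].
have szu : size (rcons s (G y z)) == m.+1 by rewrite size_rcons.
rewrite foldr_rcons -(IHm (Tuple szu) s (G y z)) //.
by apply: (@opowS _ _ _ (Tuple szs) y z) => //; rewrite tE -!cats1 -catA.
Qed.

Section Reduction.

Context {X : Type} {n : nat} {F : nary n X} {G : X -> X -> X}.
Hypothesis redG : reduction F G.

Lemma reduction_foldr (t : n.-tuple X) s z :
  t = rcons s z :> seq X -> F t = foldr G z s.
Proof.
move=> tE; have n_eq : n.-1.+1 = n.
  by rewrite -(size_tuple t) tE size_rcons.
rewrite -(opow_foldr G _ (tcast (esym n_eq) t)) ?val_tcast //.
by apply: (proj2 redG); rewrite val_tcast.
Qed.

Lemma reduction_identity (e : X) : 1 < n -> neutral F e ->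
  exists2 u : X, left_id u G & right_id u G.
Proof.
move=> n_gt1 ne; have assocG := proj1 redG.
have n_gt0 : 0 < n by apply: ltnW.
have lt_pn : n.-1 < n by rewrite prednK.
pose u := foldr G e (nseq n.-2 e); exists u => x.
  rewrite -[RHS](ne x (Ordinal lt_pn)).
  rewrite (reduction_foldr _ (nseq n.-1 e) x); last first.
    by rewrite neutral_tupleE /= subnn cats1.
  have -> : n.-1 = n.-2.+1 by lia.
  (* Associativity of [G] moves [x] from outside the power [u] to the innermost place. *)
  rewrite /u; elim: n.-2 => //= m <-.
  by rewrite assocG.
rewrite -[RHS](ne x (Ordinal n_gt0)).
rewrite (reduction_foldr _ (x :: nseq n.-2 e) e) //.
by rewrite neutral_tupleE /= subn0 rcons_nseq; congr (_ :: nseq _ _); lia.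
Qed.

Lemma identity_neutral (u : X) :
  left_id u G -> right_id u G -> neutral F u.
Proof.
move=> u1 u2 x k; have lt_kn := ltn_ord k.
have foldu m z : foldr G z (nseq m u) = z by elim: m => //= m ->.
(* If [x] is last, it is the seed of the fold; otherwise the seed is [u], and [G x u = x] is used as
   well. *)
case dE: (n.-1 - k) => [|d].
  rewrite (reduction_foldr _ (nseq k u) x) //.
  by rewrite neutral_tupleE dE cats1.
rewrite (reduction_foldr _ (nseq k u ++ x :: nseq d u) u).
  by rewrite foldr_cat /= !foldu u2.
by rewrite neutral_tupleE dE rcons_cat /= rcons_nseq.
Qed.

Lemma identity_Gop (u x y : X) : 1 < n -> left_id u G -> G x y = Gop F u x y.
Proof.
move=> n_gt1 u1; rewrite /Gop.
rewrite (reduction_foldr _ (x :: nseq n.-2 u) y) ?Gop_tupleE //=.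
by congr G; elim: n.-2 => //= m <-.
Qed.

End Reduction.

Theorem proposition1p4 (X : Type)
    (card_X : exists a b c : X, a <> b /\ a <> c /\ b <> c)
    (n : nat) (n_ge3 : 3 <= n) (F : nary n X)
    (F_assoc : nary_associative F) (E_F_nonempty : exists e : X, neutral F e) :
  (forall G : X -> X -> X, reduction F G ->
     exists2 e : X, neutral F e & forall x y : X, G x y = Gop F e x y) /\
  (forall e1 e2 : X, neutral F e1 -> neutral F e2 ->
     isomorphic_semigroups (Gop F e1) (Gop F e2)).
Proof.
have n_gt1 := ltnW n_ge3; split=> [G redG | e1 e2].
  have [e ne] := E_F_nonempty.
  have [u u1 u2] := reduction_identity redG e n_gt1 ne.
  exists u => [|x y]; first exact: (identity_neutral redG u u1 u2).
  exact: (identity_Gop redG u x y n_gt1 u1).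
exact: Gop_isomorphic.
Qed.
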